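(* Let $Q\subset X$ and $0\le\beta\le\alpha_0\le\alpha\le1$ with $\alpha\ne\beta$. Then (i) $$\mathcal J_{\alpha_0}(\Lambda,\phi_0)(Q)\le\mathcal J_\beta(\Lambda,\phi_0)(Q)^{1-\frac{\alpha_0-\beta}{\alpha-\beta}}\ \mathcal J_\alpha(\Lambda,\phi_0)(Q)^{\frac{\alpha_0-\beta}{\alpha-\beta}};$$ (ii) $$\mathcal H^{\alpha_0,0}(\Lambda,\phi_0)(Q)\le\mathcal J_\beta(\Lambda,\phi_0)(Q)^{1-\frac{\alpha_0-\beta}{\alpha-\beta}}\ \mathcal H^{\alpha,0}(\Lambda,\phi_0)(Q)^{\frac{\alpha_0-\beta}{\alpha-\beta}},\quad\text{and}$$ $$\mathcal H^{\alpha_0,0}(\Lambda,\phi_0)(Q)\le\mathcal H^{\beta,0}(\Lambda,\phi_0)(Q)^{1-\frac{\alpha_0-\beta}{\alpha-\beta}}\ \mathcal J_\alpha(\Lambda,\phi_0)(Q)^{\frac{\alpha_0-\beta}{\alpha-\beta}}.$$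
   Context: Setting. Let $X$ be a set, $S:X\to X$ a bijection, $\mathcal A$ a $\sigma$-algebra on $X$, $\mathcal A_0$ the $\sigma$-algebra generated by $\bigcup_{i\ge 0}S^{-i}\mathcal A$, and $\mathcal A_m:=S^{-m}\mathcal A_0=\{S^{-m}A:A\in\mathcal A_0\}$ for integers $m\le 0$ (so $\mathcal A_0\subset\mathcal A_{-1}\subset\cdots$). Let $\phi_0$ be a finite positive measure on $\mathcal A_0$, and $\Lambda$ a finite positive measure on $\mathcal A_0$ with $\Lambda\circ S^{-1}=\Lambda$ and $\Lambda\ll\phi_0$; let $Z\ge0$ be an $\mathcal A_0$-measurable version of $d\Lambda/d\phi_0$. For $Q\subset X$ let $\mathcal C(Q)$ be the set of all sequences $(A_m)_{m\le0}$ with $A_m\in\mathcal A_m$ for all $m\le 0$ and $Q\subset\bigcup_{m\le0}A_m$. Define $\Phi(Q):=\inf_{(A_m)\in\mathcal C(Q)}\sum_{m\le0}\phi_0(S^mA_m)$ and $\Lambda(Q):=\inf_{(A_m)\in\mathcal C(Q)}\sum_{m\le0}\Lambda(S^mA_m)$ for $Q\subset X$. Conventions: $0\log0:=0$, $y^x:=e^{x\log y}$ and thus $0^0:=1$. For $\epsilon>0$: $\mathcal C^0_\epsilon(Q):=\{(A_m)\in\mathcal C(Q):\sum_{m\le0}\phi_0(S^mA_m)<\Phi(Q)+\epsilon\}$; $\mathcal C^1_\epsilon(Q):=\{(A_m)\in\mathcal C(Q):\sum_{m\le0}\Lambda(S^mA_m)<\Lambda(Q)+\epsilon\}$; $\mathcal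 C^{0,1}_\epsilon(Q):=\{(A_m)\in\mathcal C^1_\epsilon(Q):\sum_{m\le0}\phi_0(S^mA_m)<\Phi^{\Lambda}(Q)+\epsilon\}$, where $\Phi^{\Lambda}(Q):=\lim_{\epsilon\to0}\inf_{(A_m)\in\mathcal C^1_\epsilon(Q)}\sum_{m\le0}\phi_0(S^mA_m)$ (which equals $\Phi(Q)$). For $\alpha\in[0,1]$: $\mathcal H^{\alpha,0}(\Lambda,\phi_0)(Q):=\lim_{\epsilon\to0}\inf_{(A_m)\in\mathcal C^0_\epsilon(Q)}\sum_{m\le0}\int_{S^mA_m}Z^\alpha d\phi_0$ and $\mathcal J_\alpha(\Lambda,\phi_0)(Q):=\lim_{\epsilon\to0}\sup_{(A_m)\in\mathcal C^{0,1}_\epsilon(Q)}\sum_{m\le0}\int_{S^mA_m}Z^\alpha d\phi_0$. *)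

(* Defs.v *)
From HB Require Import structures.
From mathcomp Require Import all_boot all_order all_algebra.
From mathcomp Require Import all_classical all_reals all_analysis.

Set Implicit Arguments.
Unset Strict Implicit.
Unset Printing Implicit Defensive.

Import Order.TTheory GRing.Theory Num.Theory.
Import numFieldNormedType.Exports.

Local Open Scope classical_set_scope.
Local Open Scope ring_scope.

(* Write A for the sigma-algebra of measurable sets of X.  The
   generator is the union over i >= 0 of S^-i A; no measurability of S with
   respect to A is assumed. *)
Definition past_gen (d : measure_display) (X : measurableType d) (S : X -> X) :
    set (set X) :=
  \bigcup_(i in [set: nat]) [set iter i S @^-1` A | A in measurable].

(* X equipped with A_0, the sigma-algebra generated by past_gen S. *)
Notation past_space S := (g_sigma_algebraType (past_gen S)).

Section covers.
Context (R : realType) (d : measure_display) (X : measurableType d).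
Variable S : X -> X.

(* Indices m <= 0 are written m = - n with n : nat.  Thus A_m = S^-m A_0 is the
   family of the images under S^n of the members of A_0, and, S being bijective,
   S^m B is the preimage of B under S^n. *)
Definition sigma_level (n : nat) : set (set X) :=
  [set iter n S @` B | B in <<s past_gen S >>].

Definition covers (Q : set X) : set (nat -> set X) :=
  [set A | (forall n, sigma_level n (A n)) /\ Q `<=` \bigcup_n A n].

Definition cost (mu : set X -> \bar R) (A : nat -> set X) : \bar R :=
  (\sum_(0 <= n <oo) mu (iter n S @^-1` A n))%E.

(* For mu = phi_0 this is Phi(Q), for mu = Lambda it is the extension of Lambda
   to arbitrary subsets Q. *)
Definition outer (mu : set X -> \bar R) (Q : set X) : \bar R :=
  ereal_inf [set cost mu A | A in covers Q].

(* C^0_e(Q) for mu = phi_0 and C^1_e(Q) for mu = Lambda. *)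
Definition near_covers (mu : set X -> \bar R) (Q : set X) (e : R) :
    set (nat -> set X) :=
  [set A | covers Q A /\ (cost mu A < outer mu Q + e%:E)%E].

(* Phi^Lambda(Q) *)
Definition outer_rel (Lambda phi0 : set X -> \bar R) (Q : set X) : \bar R :=
  lim (ereal_inf [set cost phi0 A | A in near_covers Lambda Q e] @[e --> 0^'+]).

(* C^{0,1}_e(Q) *)
Definition near_covers2 (Lambda phi0 : set X -> \bar R) (Q : set X) (e : R) :
    set (nat -> set X) :=
  [set A | near_covers Lambda Q e A /\
           (cost phi0 A < outer_rel Lambda phi0 Q + e%:E)%E].

End covers.

Section functionals.
Context (R : realType) (d : measure_display) (X : measurableType d).
Variable S : X -> X.
Variable phi0 : {finite_measure set (past_space S) -> \bar R}.
Variable Z : past_space S -> R.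

(* powR satisfies 0 `^ 0 = 1, so Z^0 = 1 also where Z vanishes. *)
Definition cost_pow (a : R) (A : nat -> set X) : \bar R :=
  (\sum_(0 <= n <oo) \int[phi0]_(x in iter n S @^-1` A n) (Z x `^ a)%:E)%E.

Definition Hfun (a : R) (Q : set X) : \bar R :=
  lim (ereal_inf [set cost_pow a A | A in near_covers S phi0 Q e]
       @[e --> 0^'+]).

Definition Jfun (Lambda : {finite_measure set (past_space S) -> \bar R})
    (a : R) (Q : set X) : \bar R :=
  lim (ereal_sup [set cost_pow a A | A in near_covers2 S Lambda phi0 Q e]
       @[e --> 0^'+]).

End functionals.

(* Main.v *)
(* Hoelder's inequality, in the form of the weighted AM-GM inequality
   x^(1-t) y^t <= (1-t) x + t y, bounds the Z^alpha0-cost of each single cover by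
   the product of powers of its Z^beta- and Z^alpha-costs.  To pass to the
   infimum defining H one needs covers which are nearly optimal for Phi, for
   Lambda and for H at once.  They come from two observations.
   First, for every finite measure mu on A_0 the outer measure Phi_mu is
   S-invariant: Phi_mu(Q) <= Phi_mu(S^-1 Q) by delaying a cover by one step,
   equality holds for Q in A_0 by passing to complements, and then for all Q by
   treating the level-0 set of a cover separately.  Hence all sets in the A_m are
   Caratheodory measurable and covers may be delayed at no cost; given a nearly
   optimal Lambda-cover, cut X into the disjoint first-entry sets E_j in A_-j,
   and cover each piece of Q inside E_j by a nearly mu-optimal disjoint family of
   levels at least j.  As Lambda is invariant, its cost does not exceed that of
   the given Lambda-cover.
   Second, this applied to mu = phi_0 + l Z^alpha phi_0 with l small gives covers
   that minimise first the phi_0-cost and then the Z^alpha-cost. *)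
Require Import Defs.
From HB Require Import structures.
From mathcomp Require Import all_boot all_order all_algebra.
From mathcomp Require Import all_classical all_reals all_analysis.
From mathcomp Require Import measurable_realfun ring lra.

Set Implicit Arguments.
Unset Strict Implicit.
Unset Printing Implicit Defensive.

Import Order.TTheory GRing.Theory Num.Theory.
Import numFieldNormedType.Exports.

Local Open Scope classical_set_scope.
Local Open Scope ring_scope.

Lemma cancel_iter (T : Type) (f g : T -> T) n :
  cancel f g -> cancel (iter n f) (iter n g).
Proof. by move=> fK; elim: n => // n IH x; rewrite [iter n.+1 g _]iterSr /= fK IH. Qed.

Lemma nneseries_le (R : realType) (u : nat -> \bar R) (x : \bar R) : (forall n, 0 <= u n)%E ->
  (forall N, (\sum_(0 <= n < N) u n <= x)%E) -> (\sum_(0 <= n <oo) u n <= x)%E.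
Proof.
move=> u0 ux; apply: lime_le; first exact: is_cvg_nneseries.
by apply: nearW => N; exact: ux.
Qed.

(** * Covers by past levels and their outer measures *)

Section past_covers.
Context (d : measure_display) (Y : measurableType d) (R : realType).
Variables S T : Y -> Y.
Hypotheses (TK : cancel T S) (SK : cancel S T).
Hypothesis mS : measurable_fun [set: Y] S.
Implicit Types (Q F : set Y) (B : nat -> set Y).
Local Open Scope ereal_scope.

(* With T = S^-1, a cover (A_m) of Q is encoded by the measurable sets
   B_n = S^m A_m, m = - n, so that A_m is the preimage of B_n under T^n. *)
Definition past_cover Q : set (nat -> set Y) :=
  [set B | (forall n, measurable (B n)) /\
           (forall x, Q x -> exists n, B n (iter n T x))].

Definition past_cost (mu : set Y -> \bar R) B := \sum_(0 <= n <oo) mu (B n).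

Definition past_outer (mu : set Y -> \bar R) Q : \bar R :=
  ereal_inf [set past_cost mu B | B in past_cover Q].

Lemma iterS_T n k x : (k <= n)%N -> iter (n - k) S (iter n T x) = iter k T x.
Proof. by move=> kn; rewrite -{2}(subnK kn) iterD (cancel_iter _ TK). Qed.

Lemma measurable_iter_preimage n F :
  measurable F -> measurable (iter n S @^-1` F).
Proof.
move=> mF; elim: n => // n IH.
have -> : iter n.+1 S @^-1` F = S @^-1` (iter n S @^-1` F).
  by apply/seteqP; split => x /=; rewrite -iterS iterSr.
by rewrite -[X in measurable X]setTI; exact: mS.
Qed.

(** * Splitting and shift invariance of the outer measure of one finite measure *)

Section one_measure.
Variable mu : {measure set Y -> \bar R}.
Hypothesis mu_fin : mu [set: Y] < +oo.
Local Notation cost := (past_cost mu).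
Local Notation outer := (past_outer mu).

Lemma past_cost_ge0 B : 0 <= cost B.
Proof. exact: nneseries_ge0. Qed.

Lemma past_outer_ge0 Q : 0 <= outer Q.
Proof. by apply: le_ereal_inf_tmp => _ [B _ <-]; exact: past_cost_ge0. Qed.

Lemma past_outer_le_cost Q B : past_cover Q B -> outer Q <= cost B.
Proof. by move=> QB; apply: ereal_inf_lbound; exists B. Qed.

Lemma past_outerS Q Q' : Q `<=` Q' -> outer Q <= outer Q'.
Proof.
move=> QQ'; apply: ereal_inf_le_tmp => _ [B [mB Q'B] <-]; exists B => //.
by split => // x /QQ'; exact: Q'B.
Qed.

Lemma past_cost_single F :
  cost (fun n => if n is 0%N then F else set0) = mu F.
Proof.
rewrite /past_cost nneseries_recl//= -[RHS]adde0; congr (_ + _).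
by apply: eseries0 => -[|n]//= _ _; rewrite measure0.
Qed.

Lemma past_outer_le_measure F : measurable F -> outer F <= mu F.
Proof.
move=> mF; rewrite -past_cost_single.
by apply: past_outer_le_cost; split => [[|n]//=|x Fx]; exists 0%N.
Qed.

Lemma past_outer_fin_num Q : outer Q \is a fin_num.
Proof.
rewrite ge0_fin_numE ?past_outer_ge0//.
apply: le_lt_trans mu_fin; apply: le_trans (past_outer_le_measure measurableT).
exact: past_outerS.
Qed.

Lemma past_outer_adherent Q (e : R) : (0 < e)%R ->
  exists2 B, past_cover Q B & cost B < outer Q + e%:E.
Proof.
move=> e0; have [_ [B QB <-] Be] := lb_ereal_inf_adherent e0 (past_outer_fin_num Q).
by exists B.
Qed.

Lemma past_outerU Q Q' : outer (Q `|` Q') <= outer Q + outer Q'.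
Proof.
apply/lee_addgt0Pr => e e0.
have e20 : (0 < e / 2)%R by rewrite divr_gt0.
have [B [mB QB] cB] := past_outer_adherent Q e20.
have [B' [mB' QB'] cB'] := past_outer_adherent Q' e20.
have -> : outer Q + outer Q' + e%:E
    = (outer Q + (e / 2)%:E) + (outer Q' + (e / 2)%:E).
  by rewrite {1}(splitr e) EFinD addeACA.
apply: (@le_trans _ _ (cost B + cost B')); last by rewrite leeD// ltW.
rewrite -nneseriesD//.
apply: (@le_trans _ _ (cost (fun n => B n `|` B' n))); last first.
  by apply: lee_nneseries => // n _; exact: measureU2.
apply: past_outer_le_cost; split => [n|x]; first exact: measurableU.
by move=> [/QB|/QB'] [n Bn]; exists n; [left|right].
Qed.

(** Every [B n] can be cut along S^-n F: since S^n (T^n x) = x, the point T^n x lies in S^-n F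
    exactly when x lies in [F]. The costs of the two parts add up to that of [B]. *)
Lemma past_outer_split Q F : measurable F ->
  outer (Q `&` F) + outer (Q `\` F) <= outer Q.
Proof.
move=> mF; apply: le_ereal_inf_tmp => _ [B [mB QB] <-].
have mSF n := measurable_iter_preimage n mF.
apply: (@le_trans _ _ (cost (fun n => B n `&` iter n S @^-1` F) +
                       cost (fun n => B n `\` iter n S @^-1` F))).
  apply: leeD; apply: past_outer_le_cost; split=> [n|x [Qx Fx]].
  - exact: measurableI.
  - by have [n Bn] := QB _ Qx; exists n; split => //=; rewrite (cancel_iter _ TK).
  - exact: measurableD.
  - by have [n Bn] := QB _ Qx; exists n; split => //=; rewrite (cancel_iter _ TK).
rewrite -nneseriesD//; apply: lee_nneseries => [n _ _|n _]; first exact: adde_ge0.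
by rewrite addeC -measureDI.
Qed.

(** A cover of S^-1 Q, delayed by one level with the empty set at level 0, covers [Q], because T x
    lies in S^-1 Q for x in [Q]. *)
Lemma past_outer_preimage_ge Q : outer Q <= outer (S @^-1` Q).
Proof.
apply: le_ereal_inf_tmp => _ [B [mB QB] <-].
pose B' n := if n is m.+1 then B m else set0.
have -> : cost B = cost B'.
  rewrite /past_cost [RHS]nneseries_recl//= measure0 add0e.
  rewrite -(nneseries_addn 1)//; apply: eq_eseriesr => n _.
  by rewrite addn1.
apply: past_outer_le_cost; split=> [[|n]//=|x Qx].
have [|n Bn] := QB (T x); first by rewrite /= TK.
by exists n.+1; rewrite iterSr.
Qed.

(** Splitting the whole space along S^-1 F, where the complement may only gain outer measure under
    S^-1, bounds outer (S^-1 F) + outer (~F) by outer F + outer (~F). The finite term outer (~F)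
    cancels. *)
Lemma past_outer_preimage_measurable F : measurable F ->
  outer (S @^-1` F) <= outer F.
Proof.
move=> mF.
have mSF : measurable (S @^-1` F) by exact: (measurable_iter_preimage 1).
have fin := past_outer_fin_num.
have : outer (S @^-1` F) + outer (~` F) <= outer F + outer (~` F).
  apply: (@le_trans _ _ (outer [set: Y])); last first.
    by apply: le_trans (past_outerU _ _); rewrite setUCr.
  apply: le_trans (past_outer_split setT mSF); rewrite setTI setTD.
  by rewrite leeD2l// preimage_setC; exact: past_outer_preimage_ge.
by rewrite leeD2rE.
Qed.

(** Under S^-1 the levels n + 1 of a cover move forward to n at no cost. Level 0 has no earlier
    level to move to, and the measurable case takes care of it. *)
Lemma past_outer_preimage_le Q : outer (S @^-1` Q) <= outer Q.
Proof.
apply: le_ereal_inf_tmp => _ [B [mB QB] <-].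
pose Q1 := [set x | exists n, B n.+1 (iter n T x)].
apply: (@le_trans _ _ (outer (S @^-1` B 0%N `|` Q1))).
  apply: past_outerS => x /= /QB [[|n] Bn]; [by left|right; exists n].
  by move: Bn; rewrite iterSr SK.
apply: le_trans (past_outerU _ _) _.
rewrite /past_cost nneseries_recl//; apply: leeD.
  apply: le_trans (past_outer_preimage_measurable _) _ => //.
  exact: past_outer_le_measure.
rewrite -(nneseries_addn 1)//.
apply: (@past_outer_le_cost _ (fun n => B (n + 1)%N)); split=> // x [n Bn].
by exists n; rewrite addn1.
Qed.

Lemma past_outer_preimage n Q : outer (iter n S @^-1` Q) = outer Q.
Proof.
elim: n Q => // n IH Q.
have -> : iter n.+1 S @^-1` Q = iter n S @^-1` (S @^-1` Q) by [].
rewrite IH; apply/eqP.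
by rewrite eq_le past_outer_preimage_le past_outer_preimage_ge.
Qed.

(** Taking the preimage under S^n keeps all three outer measures and turns T^-n F into [F], so the
    splitting at level 0 applies. *)
Lemma past_outer_split_iter n Q F : measurable F ->
  outer (Q `&` iter n T @^-1` F) + outer (Q `\` iter n T @^-1` F) <= outer Q.
Proof.
move=> mF.
have ST : iter n S @^-1` (iter n T @^-1` F) = F.
  by apply/seteqP; split => x /=; rewrite (cancel_iter _ SK).
rewrite -(past_outer_preimage n Q) -(past_outer_preimage n (_ `&` _)).
rewrite -(past_outer_preimage n (_ `\` _)).
by have := past_outer_split (iter n S @^-1` Q) mF; rewrite -{1 2}ST.
Qed.

End one_measure.

(** * First-entry families and their cost under an invariant measure *)

(** As S^(n-k) T^n = T^k for k <= n, the point T^n x lies in this set exactly when n is the least k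
    with T^k x in [B k]. *)
Definition first_entry B n : set Y :=
  B n `\` \bigcup_(k in [set k | (k < n)%N]) (iter (n - k) S @^-1` B k).

Lemma measurable_first_entry B n :
  (forall n, measurable (B n)) -> measurable (first_entry B n).
Proof.
move=> mB; apply: measurableD => //.
by apply: bigcup_measurable => k _; exact: measurable_iter_preimage.
Qed.

Lemma first_entry_cover Q B : past_cover Q B -> past_cover Q (first_entry B).
Proof.
move=> [mB QB]; split=> [n|x Qx]; first exact: measurable_first_entry.
have ex : exists n, `[< B n (iter n T x) >].
  by have [n Bn] := QB _ Qx; exists n; exact/asboolP.
case: (ex_minnP ex) => n /asboolP Bn nmin; exists n; split => //.
move=> [k /= kn]; rewrite (iterS_T _ (ltnW kn)) => Bk.
by have := nmin k; rewrite leqNgt kn => /(_ (introT (asboolP _) Bk)).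
Qed.

Lemma first_entry_inj B n m x : first_entry B n (iter n T x) ->
  first_entry B m (iter m T x) -> n = m.
Proof.
move=> [Bn nBn] [Bm nBm]; case: (ltngtP n m) => // h; exfalso.
- by apply: nBm; exists n => //=; rewrite iterS_T ?(ltnW h).
- by apply: nBn; exists m => //=; rewrite iterS_T ?(ltnW h).
Qed.

Section invariant_measure.
Variable nu : {measure set Y -> \bar R}.
Hypothesis invS : forall F, measurable F -> nu (S @^-1` F) = nu F.

Lemma measure_iter_preimage n F :
  measurable F -> nu (iter n S @^-1` F) = nu F.
Proof.
elim: n F => // n IH F mF.
have -> : iter n.+1 S @^-1` F = iter n S @^-1` (S @^-1` F) by [].
by rewrite IH ?invS//; exact: (measurable_iter_preimage 1).
Qed.

(* Pulling the first N sets back to the common level N makes them disjoint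
   without changing their nu-mass. *)
Lemma first_entry_cost_le F B : (forall n, measurable (B n)) -> measurable F ->
  (forall n, B n `<=` iter n S @^-1` F) ->
  past_cost nu (first_entry B) <= nu F.
Proof.
move=> mB mF BF; apply: nneseries_le => // N.
have mE n := measurable_first_entry n mB.
pose G n := if (n < N)%N then iter (N - n) S @^-1` first_entry B n else set0.
have mG n : measurable (G n).
  by rewrite /G; case: ifP => // _; exact: measurable_iter_preimage.
have tG : trivIset setT G.
  move=> n m _ _ [x []]; rewrite /G.
  case: ltnP => // nN; case: ltnP => // mN /=.
  have e k : (k < N)%N -> iter (N - k) S x = iter k T (iter N S x).
    by move=> kN; rewrite -{2}(subnKC (ltnW kN)) iterD (cancel_iter _ SK).
  by rewrite !e//; exact: first_entry_inj.
have -> : \sum_(0 <= n < N) nu (first_entry B n) = nu (\big[setU/set0]_(n < N) G n).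
  rewrite measure_semi_additive//; last exact: bigsetU_measurable.
  rewrite big_mkord; apply: eq_bigr => n _; rewrite /G ltn_ord.
  exact/esym/measure_iter_preimage.
(* All the disjoint sets [G n] lie in S^-N F, whose mass is [nu F]. *)
rewrite -(measure_iter_preimage N mF); apply: le_measure.
- by rewrite inE; exact: bigsetU_measurable.
- by rewrite inE; exact: measurable_iter_preimage.
rewrite -bigcup_mkord => x [n /= nN]; rewrite /G nN => -[/BF /=].
by rewrite -iterD subnKC// ltnW.
Qed.

(** Since [Q] lies in [F], the n-th set may be cut down to S^-n F before passing to first entries.
    Both operations only shrink sets, so the [mu]-cost does not grow. *)
Lemma cover_cost_le_measure (mu : {measure set Y -> \bar R}) F Q B :
  measurable F -> Q `<=` F -> past_cover Q B ->
  exists B', [/\ past_cover Q B', past_cost mu B' <= past_cost mu B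
               & past_cost nu B' <= nu F].
Proof.
move=> mF QF [mB QB]; pose B1 n := B n `&` iter n S @^-1` F.
have mB1 n : measurable (B1 n).
  by apply: measurableI => //; exact: measurable_iter_preimage.
exists (first_entry B1); split.
- apply: first_entry_cover; split => // x Qx; have [n Bn] := QB _ Qx.
  by exists n; split => //=; rewrite (cancel_iter _ TK); exact: QF.
- apply: lee_nneseries => // n _; apply: le_measure; rewrite ?inE//.
    exact: measurable_first_entry.
  by move=> x [[]].
- by apply: first_entry_cost_le => // n x [].
Qed.

End invariant_measure.

(** * Delayed covers, and covers nearly optimal for two measures at once *)

Definition delayed j B n : set Y := if (j <= n)%N then B (n - j)%N else set0.

Lemma delayed_cover j Q B :
  past_cover (iter j S @^-1` Q) B -> past_cover Q (delayed j B).
Proof.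
move=> [mB QB]; split=> [n|x Qx]; first by rewrite /delayed; case: ifP.
have [|n Bn] := QB (iter j T x); first by rewrite /= (cancel_iter _ TK).
by exists (n + j)%N; rewrite /delayed leq_addl addnK iterD.
Qed.

Lemma past_cost_delayed (mu : {measure set Y -> \bar R}) j B :
  past_cost mu (delayed j B) = past_cost mu B.
Proof.
rewrite /past_cost (nneseries_split _ j)// big_nat big1 ?add0e => [|n /andP[_ nj]].
  rewrite add0n -(nneseries_addn j)//; apply: eq_eseriesr => n _.
  by rewrite /delayed leq_addl addnK.
by rewrite /delayed leqNgt nj measure0.
Qed.

Lemma past_cost_bigcup_le (mu : {measure set Y -> \bar R})
    (B : nat -> nat -> set Y) : (forall j n, measurable (B j n)) ->
  past_cost mu (fun n => \bigcup_j B j n) <= \sum_(0 <= j <oo) past_cost mu (B j).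
Proof.
move=> mB; rewrite /past_cost [leRHS]nneseries_interchange//.
apply: lee_nneseries => // n _; apply: measure_sigma_subadditive => //.
exact: bigcup_measurable.
Qed.

(** The sets T^-j (first_entry B j) are disjoint and split outer measures, so they can be removed
    from [Q] one after the other. *)
Lemma past_outer_first_entry_le (mu : {measure set Y -> \bar R}) Q B :
  mu setT < +oo -> (forall n, measurable (B n)) ->
  \sum_(0 <= j <oo) past_outer mu (Q `&` iter j T @^-1` first_entry B j)
    <= past_outer mu Q.
Proof.
move=> mufin mB; apply: nneseries_le => [n|N]; first exact: past_outer_ge0.
pose E j := iter j T @^-1` first_entry B j.
(* The induction carries along the remainder [W N], which is dropped at the end. *)
pose W n := Q `\` \bigcup_(j in [set j | (j < n)%N]) E j.
suff : \sum_(0 <= j < N) past_outer mu (Q `&` E j) + past_outer mu (W N)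
       <= past_outer mu Q.
  by apply: le_trans; rewrite leeDl// past_outer_ge0.
elim: N => [|N IH].
  by rewrite big_nil add0e; apply: past_outerS => // x [].
apply: le_trans IH; rewrite big_nat_recr//= -addeA leeD2l//.
have := past_outer_split_iter mufin N (W N) (measurable_first_entry N mB).
apply: le_trans; apply: leeD; apply: past_outerS => // x.
- move=> [Qx Ex]; split => //; split => // -[j /= jN Ej].
  by have := first_entry_inj Ej Ex => jN'; rewrite jN' ltnn in jN.
- move=> [Qx nx]; split; last by move=> Ex; apply: nx; exists N => /=.
  by split => // -[j /= jN Ej]; apply: nx; exists j => //=; exact: ltnW.
Qed.

(** A nearly [nu]-optimal cover [F] cuts [Q] into the pieces [Qj j]. Since S^-j (Qj j) lies in the
    j-th first-entry set, it has a nearly [mu]-optimal cover of [nu]-cost at most the mass of that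
    set. Delaying this cover by j and uniting over j keeps both costs under control. *)
Lemma simultaneous_cover (mu nu : {measure set Y -> \bar R}) Q (e : R) :
  mu setT < +oo -> nu setT < +oo ->
  (forall F, measurable F -> nu (S @^-1` F) = nu F) -> (0 < e)%R ->
  exists B, [/\ past_cover Q B, past_cost mu B < past_outer mu Q + e%:E
              & past_cost nu B < past_outer nu Q + e%:E].
Proof.
move=> mufin nufin invS e0.
have [F QF cF] := past_outer_adherent nufin Q e0; have [mF _] := QF.
have [_ QE] := first_entry_cover QF.
pose Qj j := Q `&` iter j T @^-1` first_entry F j.
(* The errors r / 2^(j+1) sum to [r]; as [r] is less than [e], the final inequality is strict. *)
pose r := (e / 2)%R; have r0 : (0 < r)%R by rewrite divr_gt0.
have H j : exists D, [/\ past_cover (iter j S @^-1` Qj j) D,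
    past_cost mu D <= past_outer mu (Qj j) + (r / (2 ^ j.+1)%:R)%:E
    & past_cost nu D <= nu (first_entry F j)].
  have rj0 : (0 < r / (2 ^ j.+1)%:R)%R by rewrite divr_gt0// ltr0n expn_gt0.
  have [D QD cD] := past_outer_adherent mufin (iter j S @^-1` Qj j) rj0.
  have [|D' [QD' cD' nD']] := cover_cost_le_measure invS mu
    (measurable_first_entry j mF) _ QD.
    by move=> x [_] /=; rewrite (cancel_iter _ SK).
  exists D'; split => //; apply: le_trans cD' _.
  (* By shift invariance S^-j (Qj j) has the same outer measure as [Qj j]. *)
  by rewrite -(past_outer_preimage mufin j (Qj j)) ltW.
have [D HD] := choice H.
have DC j : past_cover (Qj j) (delayed j (D j)).
  by apply: delayed_cover; have [] := HD j.
have mD j n : measurable (delayed j (D j) n) by have [] := DC j.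
exists (fun n => \bigcup_j delayed j (D j) n); split.
- split=> [n|x Qx]; first exact: bigcup_measurable.
  have [j Ej] := QE _ Qx; have [n Dn] := (DC j).2 x (conj Qx Ej).
  by exists n, j.
- apply: (@le_lt_trans _ _ (past_outer mu Q + r%:E)); last first.
    rewrite lteD2lE ?past_outer_fin_num//.
    by rewrite lte_fin /r ltr_pdivrMr// mulr_natr mulr2n ltrDr.
  apply: le_trans (past_cost_bigcup_le _ mD) _.
  apply: (@le_trans _ _ (\sum_(0 <= j <oo)
      (past_outer mu (Qj j) + (r / (2 ^ j.+1)%:R)%:E))).
    apply: lee_nneseries => [n _ _|n _]; first exact: past_cost_ge0.
    by rewrite past_cost_delayed; have [] := HD n.
  apply: le_trans (epsilon_trick _ _ (ltW r0)) _ => [n|].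
    exact: past_outer_ge0.
  by rewrite leeD2r//; exact: past_outer_first_entry_le.
- apply: le_lt_trans cF; apply: le_trans (past_cost_bigcup_le _ mD) _.
  apply: lee_nneseries => [n _ _|n _]; first exact: past_cost_ge0.
  rewrite past_cost_delayed; have [_ _ h] := HD n; apply: le_trans h _.
  apply: le_measure; rewrite ?inE//; last by move=> x [].
  exact: measurable_first_entry.
Qed.

End past_covers.

(** * Inequalities and limits for real powers *)

Section real_inequalities.
Context (R : realType).
Implicit Types a b s t x : R.

(** The case a = 0 is separate because of 0^0 = 1: for s = 0 the function is constantly 1, and for s
    > 0 it tends to 0. *)
Lemma powR_cvg_at_right a s : 0 <= a -> 0 <= s ->
  (a + e) `^ s @[e --> 0^'+] --> a `^ s.
Proof.
rewrite le_eqVlt => /predU1P[<-|a0].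
  rewrite le_eqVlt => /predU1P[<-|s0].
    by under eq_fun do rewrite powRr0; rewrite powRr0; exact: cvg_cst.
  by under eq_fun do rewrite add0r; rewrite powR0 ?gt_eqF//; exact: powR_cvg0.
move=> _; have c : {for a, continuous (@powR R ^~ s)}.
  apply: differentiable_continuous; apply/derivable1_diffP.
  by apply: derivable_powR; rewrite in_itv/= andbT.
have ae : a + e @[e --> 0^'+] --> a.
  rewrite -[X in _ --> X]addr0; apply: cvgD; first exact: cvg_cst.
  exact: cvg_at_right_filter.
exact: (cvg_comp _ (@powR R ^~ s) ae c).
Qed.

Lemma le_powR_prod_at_right x a b s t : 0 <= a -> 0 <= b -> 0 <= s -> 0 <= t ->
  (forall e, 0 < e -> x <= (a + e) `^ s * (b + e) `^ t) ->
  x <= a `^ s * b `^ t.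
Proof.
move=> a0 b0 s0 t0 H.
have c : (a + e) `^ s * (b + e) `^ t @[e --> 0^'+] --> a `^ s * b `^ t.
  by apply: cvgM; exact: powR_cvg_at_right.
rewrite -(cvg_lim _ c)//; apply: limr_ge; first by apply/cvg_ex; eexists; exact: c.
by near=> e; apply: H; near: e; exact: nbhs_right_gt.
Unshelve. all: by end_near. Qed.

(** Young's inequality with exponents 1/(1-t) and 1/t; the endpoints, where one exponent would be
    infinite, are checked directly. *)
Lemma powR_weighted_AMGM a b t : 0 <= a -> 0 <= b -> 0 <= t -> t <= 1 ->
  a `^ (1 - t) * b `^ t <= (1 - t) * a + t * b.
Proof.
move=> a0 b0; rewrite le_eqVlt => /predU1P[<- _|t0].
  by rewrite subr0 powRr0 powRr1// mul0r mul1r mulr1 addr0.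
rewrite le_eqVlt => /predU1P[->|t1].
  by rewrite subrr powRr0 powRr1// mul0r !mul1r add0r.
have t1' : 0 < 1 - t by rewrite subr_gt0.
have := @conjugate_powR R (a `^ (1 - t)) (b `^ t) (1 - t)^-1 t^-1.
rewrite -!powRrM !mulfV ?gt_eqF// !powRr1// !invrK.
rewrite (mulrC a) (mulrC b); apply; rewrite ?powR_ge0 ?invr_gt0//.
by rewrite subrK.
Qed.

(** Weighted AM-GM for x^be / a and x^al / b. The bound is linear in x^be and x^al, so it can be
    integrated and summed over a cover. *)
Lemma powR_interpolate x a b al be t : 0 <= x -> 0 < a -> 0 < b ->
  0 <= al -> 0 <= be -> 0 <= t -> t <= 1 ->
  x `^ ((1 - t) * be + t * al) <=
    (a `^ (1 - t) * b `^ t) * ((1 - t) / a * x `^ be + t / b * x `^ al).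
Proof.
move=> x0 a0 b0 al0 be0 t0 t1.
have t1' : 0 <= 1 - t by rewrite subr_ge0.
have -> : x `^ ((1 - t) * be + t * al) = (x `^ be) `^ (1 - t) * (x `^ al) `^ t.
  rewrite -!powRrM (mulrC be) (mulrC al).
  (* At x = 0 the exponent law needs a nonzero total exponent; if the total vanishes, both summands
     do and all powers are 1. *)
  have [/eqP|nz] := eqVneq ((1 - t) * be + t * al) 0; last first.
    by rewrite powRD// (negbTE nz).
  rewrite paddr_eq0 ?mulr_ge0// => /andP[/eqP-> /eqP->].
  by rewrite addr0 powRr0 mulr1.
have e (y c : R) : 0 < c -> y = c * (y / c).
  by move=> c0; rewrite mulrCA divff ?mulr1 ?gt_eqF.
rewrite [in leLHS](e (x `^ be) a)// [in leLHS](e (x `^ al) b)//.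
rewrite (@powRM _ a) ?(@powRM _ b) ?divr_ge0 ?powR_ge0 ?(ltW a0) ?(ltW b0)// mulrACA.
apply: ler_wpM2l; first by rewrite mulr_ge0 ?powR_ge0.
apply: le_trans (powR_weighted_AMGM _ _ t0 t1) _; rewrite ?divr_ge0 ?powR_ge0 ?(ltW a0) ?(ltW b0)//.
by rewrite !mulrA (mulrAC (1 - t)) (mulrAC t).
Qed.

End real_inequalities.

(** * Measures with density Z^a and Hoelder's inequality for one cover *)

Section power_density.
Context (d : measure_display) (Y : measurableType d) (R : realType).
Variable phi : {measure set Y -> \bar R}.
Variable Z : Y -> R.
Hypothesis mZ : measurable_fun [set: Y] Z.
Local Open Scope ereal_scope.

Lemma measurable_EFin_powR (a : R) (A : set Y) :
  measurable_fun A (fun x => (Z x `^ a)%:E).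
Proof.
apply: measurable_funTS; apply/measurable_EFinP.
exact: (measurableT_comp (measurable_powR a) mZ).
Qed.

(** Measurability of [Z] is an argument so that a measure structure can be attached to the function
    itself. *)
Definition pow_density of measurable_fun [set: Y] Z := fun (a : R) (A : set Y) =>
  \int[phi]_(x in A) (Z x `^ a)%:E.

Section pow_density_measure.
Variable a : R.
Local Notation nu := (pow_density mZ a).

Let nu0 : nu set0 = 0. Proof. exact: integral_set0. Qed.

Let nu_ge0 A : 0 <= nu A.
Proof. by apply: integral_ge0 => x _; rewrite lee_fin powR_ge0. Qed.

Let nu_sigma : semi_sigma_additive nu.
Proof.
apply: semi_sigma_additive_nng_induced => [|x].
  exact: measurable_EFin_powR.
by rewrite lee_fin powR_ge0.
Qed.

HB.instance Definition _ := isMeasure.Build d Y R nu nu0 nu_ge0 nu_sigma.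

End pow_density_measure.

Lemma past_cost_interpolate (a b al be t : R) (B : nat -> set Y) :
  (forall x, (0 <= Z x)%R) -> (forall n, measurable (B n)) ->
  (0 < a)%R -> (0 < b)%R -> (0 <= al)%R -> (0 <= be)%R ->
  (0 <= t)%R -> (t <= 1)%R ->
  past_cost (pow_density mZ be) B <= a%:E ->
  past_cost (pow_density mZ al) B <= b%:E ->
  past_cost (pow_density mZ ((1 - t) * be + t * al)) B
    <= (a `^ (1 - t) * b `^ t)%:E.
Proof.
move=> Z0 mB a0 b0 al0 be0 t0 t1 ca cb.
set g := (a `^ (1 - t) * b `^ t)%R.
have g0 : (0 <= g)%R by rewrite mulr_ge0 ?powR_ge0.
(* These are the coefficients of the pointwise bound; they satisfy c1 a + c2 b = g. *)
pose c1 := (g * ((1 - t) / a))%R; pose c2 := (g * (t / b))%R.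
have c10 : (0 <= c1)%R by rewrite mulr_ge0// divr_ge0 ?subr_ge0// ltW.
have c20 : (0 <= c2)%R by rewrite mulr_ge0// divr_ge0// ltW.
have pos s n : 0 <= pow_density mZ s (B n) by exact: measure_ge0.
apply: (@le_trans _ _ (c1%:E * past_cost (pow_density mZ be) B +
                       c2%:E * past_cost (pow_density mZ al) B)).
  rewrite -!nneseriesZl// -nneseriesD//; last 2 first.
  - by move=> *; exact: mule_ge0.
  - by move=> *; exact: mule_ge0.
  apply: lee_nneseries => // n _; rewrite /pow_density.
  have mp s := @measurable_EFin_powR s (B n).
  have p0 s x : B n x -> 0 <= (Z x `^ s)%:E by rewrite lee_fin powR_ge0.
  rewrite -!ge0_integralZl_EFin//; [|exact: p0|exact: p0].
  rewrite -ge0_integralD//; last 4 first.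
  - by move=> x Bx; rewrite mule_ge0// lee_fin ?powR_ge0.
  - exact: measurable_funeM.
  - by move=> x Bx; rewrite mule_ge0// lee_fin ?powR_ge0.
  - exact: measurable_funeM.
  apply: ge0_le_integral => //.
  - exact: p0.
  - by apply: emeasurable_funD; exact: measurable_funeM.
  move=> x Bx; rewrite -!EFinM -EFinD lee_fin.
  apply: le_trans (powR_interpolate (Z0 x) a0 b0 al0 be0 t0 t1) _.
  by rewrite /c1 /c2 /g mulrDr !mulrA.
apply: (@le_trans _ _ (c1%:E * a%:E + c2%:E * b%:E)).
  by apply: leeD; apply: lee_wpmul2l; rewrite ?lee_fin.
rewrite -!EFinM -EFinD lee_fin le_eqVlt; apply/orP; left; apply/eqP.
by rewrite /c1 /c2; field; rewrite !gt_eqF.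
Qed.

End power_density.

(** * Minimising two costs in lexicographic order *)

Section lexicographic.
Context (d : measure_display) (Y : measurableType d) (R : realType).
Variables S T : Y -> Y.
Hypotheses (TK : cancel T S) (SK : cancel S T).
Hypothesis mS : measurable_fun [set: Y] S.
Local Open Scope ereal_scope.

(* A cover that is nearly optimal for mu + l psi with l small nearly minimises
   the psi-cost among the covers that are nearly optimal for mu. *)
Lemma lexicographic_cover (mu psi nu : {measure set Y -> \bar R}) Q (M e : R) :
  mu setT < +oo -> psi setT < +oo -> nu setT < +oo ->
  (forall F, measurable F -> nu (S @^-1` F) = nu F) ->
  (forall e', (0 < e')%R -> exists B, [/\ past_cover T Q B,
     past_cost mu B < past_outer T mu Q + e'%:E & past_cost psi B < M%:E]) ->
  (0 < e)%R ->
  exists B, [/\ past_cover T Q B, past_cost mu B < past_outer T mu Q + e%:E,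
     past_cost nu B < past_outer T nu Q + e%:E & past_cost psi B < (M + e)%:E].
Proof.
move=> mufin psifin nufin invS H e0.
have M0 : (0 < M)%R.
  have [B [_ _ h]] := H _ e0; rewrite -lte_fin; apply: le_lt_trans h.
  exact: past_cost_ge0.
(* This choice gives l M < e / 3. With r = l e / 3 <= e / 3 the total error l M + 2 r is below [e],
   and after division by [l] it is M + 2 e / 3, below M + e. *)
pose l := (e / (3 * M + e))%R.
have den0 : (0 < 3 * M + e)%R by rewrite addr_gt0// mulr_gt0.
have l0 : (0 < l)%R by rewrite divr_gt0.
have lM : (l * (3 * M + e) = e)%R by rewrite divfK ?gt_eqF.
have lMe : (l * M < e / 3)%R.
  suff : (0 < l * e)%R by lra.
  exact: mulr_gt0.
have l1 : (l <= 1)%R by rewrite ler_pdivrMr// mul1r lerDr ltW// mulr_gt0.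
pose r := (l * e / 3)%R.
have r0 : (0 < r)%R by rewrite !mulr_gt0 ?invr_gt0.
have re : (r <= e / 3)%R.
  by rewrite ler_pM2r ?invr_gt0// ler_piMl// ltW.
pose m : {measure set Y -> \bar R} := measure_add mu (mscale (NngNum (ltW l0)) psi).
have mE A : m A = mu A + l%:E * psi A by exact: measure_addE.
have mfin : m setT < +oo.
  rewrite mE lte_add_pinfty//; by apply: lte_mul_pinfty; rewrite ?lee_fin ?(ltW l0).
have cE B : past_cost m B = past_cost mu B + l%:E * past_cost psi B.
  rewrite /past_cost -nneseriesZl// -nneseriesD//.
  - by apply: eq_eseriesr => n _; rewrite mE.
  - by move=> *; rewrite mule_ge0// lee_fin ltW.
have [C [QC cC nC]] := simultaneous_cover TK SK mS Q mfin nufin invS r0.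
have [B [QB cB pB]] := H _ r0.
have [v vE] : exists v, past_outer T mu Q = v%:E.
  have := past_outer_fin_num T mufin Q.
  by exists (fine (past_outer T mu Q)); rewrite fineK.
rewrite vE in cB *.
(* The cover [B] serves as a competitor for mu + l psi; one [r] is its own error, the other that of
   [C]. *)
have hm : past_cost mu C + l%:E * past_cost psi C < (v + r + l * M + r)%:E.
  rewrite -cE; apply: lt_le_trans cC _; rewrite !EFinD leeD2r//.
  apply: le_trans (past_outer_le_cost _ QB) _; rewrite cE.
  by apply: leeD; [exact: ltW|rewrite (EFinM l M); apply: lee_wpmul2l; rewrite ?lee_fin ltW].
have oC : v%:E <= past_cost mu C by rewrite -vE; exact: past_outer_le_cost.
have c0 : 0 <= past_cost mu C by exact: past_cost_ge0.
have p0 : 0 <= past_cost psi C by exact: past_cost_ge0.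
have cfin : past_cost mu C \is a fin_num.
  rewrite ge0_fin_numE//; apply: le_lt_trans (lt_trans hm (ltry _)).
  by rewrite leeDl// mule_ge0// lee_fin ltW.
have pfin : past_cost psi C \is a fin_num.
  rewrite ge0_fin_numE// ltNge leye_eq; apply/negP => /eqP pE.
  by move: hm; rewrite pE gt0_muley ?lte_fin// addey// -ltNye (lt_le_trans _ c0).
exists C; split => //; last 1 first.
(* The [mu]-cost of [C] is at least [v], so what exceeds [v] in the bound controls l times the
   [psi]-cost. *)
- move: hm oC; rewrite -(fineK cfin) -(fineK pfin) -EFinM -EFinD !lte_fin lee_fin.
  set x := fine _; set y := fine _ => h1 h2.
  have : (l * y < l * (M + e))%R by rewrite /r in h1; lra.
  by rewrite ltr_pM2l.
- move: hm p0; rewrite -(fineK cfin) -(fineK pfin) -EFinM -!EFinD !lte_fin lee_fin.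
  set x := fine _; set y := fine _ => h1 h2.
  have : (0 <= l * y)%R by rewrite mulr_ge0// ltW.
  by lra.
- apply: lt_le_trans nC _; rewrite leeD2l// lee_fin; lra.
Qed.

End lexicographic.

(** * One-sided limits of monotone extended-real functions *)

Section limits_at_right.
Context (R : realType).
Local Open Scope ereal_scope.

Lemma lim_at_right_nondecreasing (f : R -> \bar R) :
  (forall x y : R, (0 < x)%R -> (x <= y)%R -> f x <= f y) ->
  lim (f e @[e --> 0^'+]) = ereal_inf [set f e | e in [set e | (0 < e)%R]].
Proof.
move=> ndf; rewrite -set_itvoy; apply: cvg_lim => //.
apply: nondecreasing_at_right_cvge => // x y + _ xy.
by rewrite in_itv/= andbT => x0; exact: ndf.
Qed.

Lemma lim_at_right_nonincreasing (f : R -> \bar R) :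
  (forall x y : R, (0 < x)%R -> (x <= y)%R -> f y <= f x) ->
  lim (f e @[e --> 0^'+]) = ereal_sup [set f e | e in [set e | (0 < e)%R]].
Proof.
move=> nif; rewrite -set_itvoy; apply: cvg_lim => //.
apply: nonincreasing_at_right_cvge => // x y + _ xy.
by rewrite in_itv/= andbT => x0; exact: nif.
Qed.

Lemma le_poweR_prod_at_right (x : \bar R) (a b s t : R) :
  (0 <= a)%R -> (0 <= b)%R -> (0 <= s)%R -> (0 <= t)%R ->
  (forall e, (0 < e)%R -> x <= ((a + e) `^ s * (b + e) `^ t)%:E) ->
  x <= a%:E `^ s * b%:E `^ t.
Proof.
move=> a0 b0 s0 t0; rewrite !poweR_EFin -EFinM.
case: x => [x| |] H; last exact: leNye.
  by rewrite lee_fin; exact: le_powR_prod_at_right.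
by have := H 1%R ltr01; rewrite leye_eq.
Qed.

End limits_at_right.

(** * Translation between the covers (A_m) and their encoding *)

Section past_space.
Context (R : realType) (d : measure_display) (X : measurableType d).
Variables S T : X -> X.
Hypotheses (TK : cancel T S) (SK : cancel S T).

(** A preimage under [S] turns S^-i A into S^-(i+1) A, so generators go to generators. *)
Lemma measurable_past_shift :
  measurable_fun [set: past_space S] (S : past_space S -> past_space S).
Proof.
apply: (@measurability _ _ (past_space S) (past_space S) setT S (past_gen S)) => //.
move=> _ [_ [i _ [A mA <-]] <-]; rewrite setTI.
apply: sub_sigma_algebra; exists i.+1 => //; exists A => //.
by apply/seteqP; split => x /=; rewrite -iterSr.
Qed.

Lemma covers_past_cover Q A : covers S Q A ->
  @past_cover _ (past_space S) T Q (fun n => iter n S @^-1` A n).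
Proof.
move=> [lA QA]; split=> [n|x /QA [n _ Ax]].
  have [B mB <-] := lA n.
  rewrite (_ : _ @^-1` _ = B)//; apply/seteqP; split => x /=; last by exists x.
  by move=> [y By /(can_inj (cancel_iter n SK)) <-].
by exists n => /=; rewrite (cancel_iter _ TK).
Qed.

Lemma past_cover_covers Q B : @past_cover _ (past_space S) T Q B ->
  covers S Q (fun n => iter n T @^-1` B n).
Proof.
move=> [mB QB]; split=> [n|x /QB [n Bx]]; last by exists n.
exists (B n); first exact: mB.
apply/seteqP; split => x /=.
  by move=> [y By <-]; rewrite (cancel_iter _ SK).
by move=> Bx; exists (iter n T x) => //; rewrite (cancel_iter _ TK).
Qed.

Lemma preimage_iterK B :
  (fun n => iter n S @^-1` (iter n T @^-1` B n)) = B :> (nat -> set X).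
Proof.
apply/funext => n; apply/seteqP; split => x /=; by rewrite (cancel_iter _ SK).
Qed.

Lemma outer_past_outer (mu : set X -> \bar R) Q :
  outer S mu Q = @past_outer _ (past_space S) R T mu Q.
Proof.
congr ereal_inf; apply/seteqP; split => _ [A QA <-].
  by exists (fun n => iter n S @^-1` A n) => //; exact: covers_past_cover.
exists (fun n => iter n T @^-1` A n); first exact: past_cover_covers.
by rewrite /cost; under eq_eseriesr do rewrite (congr1 (@^~ _) (preimage_iterK A)).
Qed.

End past_space.

(** * The functionals H and J: finiteness and nearly optimal covers *)

Section dynamical_functionals.
Context (R : realType) (d : measure_display) (X : measurableType d).
Variables S T : X -> X.
Hypotheses (TK : cancel T S) (SK : cancel S T).
Variables phi0 Lambda : {finite_measure set (past_space S) -> \bar R}.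
Hypothesis invL : forall A : set (past_space S), measurable A ->
  Lambda (S @^-1` A) = Lambda A.
Variable Z : past_space S -> R.
Hypothesis Z_ge0 : forall x, 0 <= Z x.
Hypothesis Z_meas : measurable_fun setT Z.
Hypothesis Z_density : forall A : set (past_space S), measurable A ->
  Lambda A = (\int[phi0]_(x in A) (Z x)%:E)%E.
Variable Q : set X.
Implicit Types (a b e : R) (A : nat -> set X).
Local Open Scope ereal_scope.

Let mS := @measurable_past_shift _ _ S.
Let phi0_fin : phi0 setT < +oo. Proof. exact: fin_num_fun_lty. Qed.
Let Lambda_fin : Lambda setT < +oo. Proof. exact: fin_num_fun_lty. Qed.

Lemma cost_pow_past a A : cost_pow phi0 Z a A =
  past_cost (pow_density phi0 Z_meas a) (fun n => iter n S @^-1` A n).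
Proof. by []. Qed.

Lemma cost_pow_ge0 a A : 0 <= cost_pow phi0 Z a A.
Proof. by rewrite cost_pow_past; exact: past_cost_ge0. Qed.

Lemma covers_measurable A : covers S Q A ->
  forall n, measurable (iter n S @^-1` A n : set (past_space S)).
Proof. by move=> /(covers_past_cover TK SK)[]. Qed.

Section one_sequence.
Variable A : nat -> set X.
Hypothesis mA : forall n, measurable (iter n S @^-1` A n : set (past_space S)).

Lemma cost_pow0 : cost_pow phi0 Z 0 A = cost S phi0 A.
Proof.
apply: eq_eseriesr => n _.
under eq_integral do rewrite powRr0.
by rewrite integral_cst// mul1e.
Qed.

Lemma cost_pow1 : cost_pow phi0 Z 1 A = cost S Lambda A.
Proof.
apply: eq_eseriesr => n _; rewrite Z_density; last exact: mA.
by apply: eq_integral => x _; rewrite powRr1.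
Qed.

Lemma cost_pow_interpolate a b al be t :
  (0 < a)%R -> (0 < b)%R -> (0 <= al)%R -> (0 <= be)%R ->
  (0 <= t)%R -> (t <= 1)%R ->
  cost_pow phi0 Z be A <= a%:E -> cost_pow phi0 Z al A <= b%:E ->
  cost_pow phi0 Z ((1 - t) * be + t * al) A <= (a `^ (1 - t) * b `^ t)%:E.
Proof.
by move=> a0 b0 al0 be0 t0 t1; rewrite !cost_pow_past; exact: past_cost_interpolate.
Qed.

(** Interpolation between the exponents 0 and 1, whose costs are those of [phi0] and [Lambda], with
    the common bound K = K^(1-a) K^a. *)
Lemma cost_pow_le a (K : R) : (0 <= a)%R -> (a <= 1)%R -> (0 < K)%R ->
  cost S phi0 A <= K%:E -> cost S Lambda A <= K%:E -> cost_pow phi0 Z a A <= K%:E.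
Proof.
move=> a0 a1 K0; rewrite -cost_pow0 -cost_pow1 => h0 h1.
have KE : (K `^ (1 - a) * K `^ a = K)%R.
  rewrite -powRD ?subrK; first by rewrite powRr1// ltW.
  by rewrite gt_eqF// implybT.
have aE : (a = (1 - a) * 0 + a * 1)%R by rewrite mulr0 add0r mulr1.
have := cost_pow_interpolate K0 K0 ler01 (lexx 0%R) a0 a1 h0 h1.
by rewrite KE -aE.
Qed.

End one_sequence.

Lemma simultaneous_near_covers e : (0 < e)%R ->
  exists A, near_covers S Lambda Q e A /\ near_covers S phi0 Q e A.
Proof.
move=> e0.
have [B [QB cB lB]] := @simultaneous_cover _ (past_space S) _ _ _ TK SK mS
  phi0 Lambda Q e phi0_fin Lambda_fin invL e0.
exists (fun n => iter n T @^-1` B n).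
have QA := past_cover_covers TK SK QB.
have cE (mu : set X -> \bar R) :
    cost S mu (fun n => iter n T @^-1` B n) = @past_cost _ (past_space S) R mu B.
  by apply: eq_eseriesr => n _; rewrite (congr1 (@^~ n) (preimage_iterK SK B)).
by split; split=> //; rewrite (outer_past_outer TK SK) cE.
Qed.

(** The infimum under the limit is constant in e > 0, since covers nearly optimal for [Lambda] and
    [phi0] together exist at every tolerance. *)
Lemma outer_rel_outer : outer_rel S Lambda phi0 Q = outer S phi0 Q.
Proof.
apply: lim_near_cst => //; near=> e.
have e0 : (0 < e)%R by near: e; exact: nbhs_right_gt.
apply/eqP; rewrite eq_le; apply/andP; split; last first.
  by apply: ereal_inf_le_tmp => _ [A [QA _] <-]; exists A.
apply/lee_addgt0Pr => r r0.
have [|A [[QA lA] [_ cA]]] := @simultaneous_near_covers (Num.min e r).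
  by rewrite lt_min e0.
apply: (@le_trans _ _ (cost S phi0 A)).
  apply: ereal_inf_lbound; exists A => //; split => //.
  by apply: lt_le_trans lA _; rewrite leeD2l// lee_fin ge_min lexx.
apply/ltW/(lt_le_trans cA).
by rewrite leeD2l// lee_fin ge_min lexx orbT.
Unshelve. all: by end_near. Qed.

Lemma near_covers2E e : near_covers2 S Lambda phi0 Q e =
  near_covers S Lambda Q e `&` near_covers S phi0 Q e.
Proof.
apply/seteqP; split => A; rewrite /near_covers2 /= outer_rel_outer.
  by move=> [[QA lA] cA]; split.
by move=> [lA [_ cA]]; split.
Qed.

Lemma near_coversS (mu : set X -> \bar R) e e' : (e <= e')%R ->
  near_covers S mu Q e `<=` near_covers S mu Q e'.
Proof.
move=> ee' A [QA cA]; split => //; apply: lt_le_trans cA _.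
by rewrite leeD2l// lee_fin.
Qed.

Lemma near_covers2S e e' : (e <= e')%R ->
  near_covers2 S Lambda phi0 Q e `<=` near_covers2 S Lambda phi0 Q e'.
Proof.
move=> ee' A; rewrite !near_covers2E.
by move=> [lA cA]; split; exact: near_coversS ee' _ _.
Qed.

Let hinf a e := ereal_inf [set cost_pow phi0 Z a A | A in near_covers S phi0 Q e].
Let jsup a e :=
  ereal_sup [set cost_pow phi0 Z a A | A in near_covers2 S Lambda phi0 Q e].

(** The families of covers shrink with [e], so the infima increase to their limit; for J the suprema
    decrease. *)
Lemma HfunE a : Hfun phi0 Z a Q = ereal_sup [set hinf a e | e in [set e | (0 < e)%R]].
Proof.
apply: lim_at_right_nonincreasing => e e' _ ee'; apply: ereal_inf_le_tmp.
by apply: image_subset; exact: near_coversS.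
Qed.

Lemma JfunE a :
  Jfun phi0 Z Lambda a Q = ereal_inf [set jsup a e | e in [set e | (0 < e)%R]].
Proof.
apply: lim_at_right_nondecreasing => e e' _ ee'; apply: ereal_sup_le.
by apply: image_subset; exact: near_covers2S.
Qed.

Lemma near_covers_cost_le (mu : {finite_measure set (past_space S) -> \bar R}) A :
  near_covers S mu Q 1 A -> cost S mu A <= mu setT + 1.
Proof.
move=> [_ /ltW cA]; apply: le_trans cA _; rewrite leeD2r//.
rewrite (outer_past_outer TK SK).
apply: le_trans (@past_outer_le_measure _ (past_space S) _ T mu setT _) => //.
exact: past_outerS.
Qed.

(** A common bound for the costs of all covers of tolerance 1; the summand 1 is that tolerance. *)
Let K : R := fine (phi0 setT) + fine (Lambda setT) + 1.

Let K_gt0 : (0 < K)%R.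
Proof. by rewrite ltr_wpDl// addr_ge0// fine_ge0. Qed.

Let phi0_le_K : phi0 setT + 1 <= K%:E.
Proof.
have : (0 <= fine (Lambda setT))%R by exact: fine_ge0.
by rewrite -(fineK (fin_num_measure phi0 _ measurableT)) -EFinD lee_fin /K; lra.
Qed.

Let Lambda_le_K : Lambda setT + 1 <= K%:E.
Proof.
have : (0 <= fine (phi0 setT))%R by exact: fine_ge0.
by rewrite -(fineK (fin_num_measure Lambda _ measurableT)) -EFinD lee_fin /K; lra.
Qed.

Lemma pow_density_fin a : (0 <= a)%R -> (a <= 1)%R ->
  pow_density phi0 Z_meas a setT < +oo.
Proof.
move=> a0 a1; pose A n : set X := if n is 0%N then setT else set0.
have cE (mu : {measure set (past_space S) -> \bar R}) : cost S mu A = mu setT.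
  by rewrite -past_cost_single; apply: eq_eseriesr => -[|n].
rewrite -cE; apply: (@le_lt_trans _ _ K%:E); last exact: ltry.
apply: cost_pow_le => //; first by case=> [|n]; [exact: measurableT|exact: measurable0].
- by rewrite cE; apply: le_trans phi0_le_K; rewrite leeDl.
- by rewrite cE; apply: le_trans Lambda_le_K; rewrite leeDl.
Qed.

Lemma near_covers2_cost_bound a A :
  (0 <= a)%R -> (a <= 1)%R -> near_covers2 S Lambda phi0 Q 1 A ->
  cost_pow phi0 Z a A <= K%:E.
Proof.
move=> a0 a1; rewrite near_covers2E => -[lA cA].
apply: cost_pow_le => //; first by apply: covers_measurable; case: lA.
- exact: le_trans (near_covers_cost_le cA) _.
- exact: le_trans (near_covers_cost_le lA) _.
Qed.

Lemma near_covers2_nonempty e : (0 < e)%R ->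
  exists A, near_covers2 S Lambda phi0 Q e A.
Proof. by move=> /simultaneous_near_covers[A HA]; exists A; rewrite near_covers2E. Qed.

Lemma hinf_le_Hfun a e : (0 < e)%R -> hinf a e <= Hfun phi0 Z a Q.
Proof. by move=> e0; rewrite HfunE; apply: ereal_sup_ubound; exists e. Qed.

Lemma Hfun_le a e (x : \bar R) : (0 < e)%R ->
  (forall r, (0 < r)%R -> (r <= e)%R -> hinf a r <= x) -> Hfun phi0 Z a Q <= x.
Proof.
move=> e0 H; rewrite HfunE; apply: ge_ereal_sup => _ [r /= r0 <-].
apply: (@le_trans _ _ (hinf a (Num.min r e))).
  apply: ereal_inf_le_tmp; apply: image_subset; apply: near_coversS.
  by rewrite ge_min lexx.
by apply: H; rewrite ?lt_min ?r0// ge_min lexx orbT.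
Qed.

Lemma Hfun_fin a : (0 <= a)%R -> (a <= 1)%R ->
  exists2 h : R, (0 <= h)%R & Hfun phi0 Z a Q = h%:E.
Proof.
move=> a0 a1.
have H0 : 0 <= Hfun phi0 Z a Q.
  apply: le_trans (hinf_le_Hfun a ltr01).
  by apply: le_ereal_inf_tmp => _ [A _ <-]; exact: cost_pow_ge0.
have HleK : Hfun phi0 Z a Q <= K%:E.
  apply: (Hfun_le ltr01) => r r0 r1; have [A hA] := near_covers2_nonempty r0.
  apply: le_trans (near_covers2_cost_bound a0 a1 (near_covers2S r1 hA)).
  by apply: ereal_inf_lbound; exists A => //; move: hA; rewrite near_covers2E => -[].
have Hfin : Hfun phi0 Z a Q \is a fin_num.
  by rewrite ge0_fin_numE//; exact: le_lt_trans HleK (ltry _).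
by exists (fine (Hfun phi0 Z a Q)); [exact: fine_ge0|rewrite fineK].
Qed.

Lemma Jfun_fin a : (0 <= a)%R -> (a <= 1)%R ->
  exists2 j : R, (0 <= j)%R & Jfun phi0 Z Lambda a Q = j%:E.
Proof.
move=> a0 a1.
have J0 : 0 <= Jfun phi0 Z Lambda a Q.
  rewrite JfunE; apply: le_ereal_inf_tmp => _ [e /= e0 <-].
  have [A hA] := near_covers2_nonempty e0.
  by apply: le_trans (cost_pow_ge0 a A) _; apply: ereal_sup_ubound; exists A.
have JleK : Jfun phi0 Z Lambda a Q <= K%:E.
  rewrite JfunE; apply: (@le_trans _ _ (jsup a 1)).
    by apply: ereal_inf_lbound; exists 1%R => //=.
  by apply: ge_ereal_sup => _ [A hA <-]; exact: near_covers2_cost_bound.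
have Jfin : Jfun phi0 Z Lambda a Q \is a fin_num.
  by rewrite ge0_fin_numE//; exact: le_lt_trans JleK (ltry _).
by exists (fine (Jfun phi0 Z Lambda a Q)); [exact: fine_ge0|rewrite fineK].
Qed.

Lemma Jfun_adherent a r : (0 <= a)%R -> (a <= 1)%R -> (0 < r)%R ->
  exists2 e, (0 < e)%R & forall A, near_covers2 S Lambda phi0 Q e A ->
    cost_pow phi0 Z a A <= Jfun phi0 Z Lambda a Q + r%:E.
Proof.
move=> a0 a1 r0; have [j j0 jE] := Jfun_fin a0 a1.
have : Jfun phi0 Z Lambda a Q < Jfun phi0 Z Lambda a Q + r%:E.
  by rewrite jE -EFinD lte_fin ltrDl.
rewrite {1}JfunE => /ereal_inf_lt[_ [e /= e0 <-] /ltW h].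
exists e => // A hA; apply: le_trans h.
by apply: ereal_sup_ubound; exists A.
Qed.

(** H is an infimum over nearly [phi0]-optimal covers only. The lexicographic argument, with Z^a
    phi0 as second cost, finds among them one that is nearly optimal for [Lambda] too, so that J can
    be applied to it. *)
Lemma Hfun_adherent a e r : (0 <= a)%R -> (a <= 1)%R -> (0 < e)%R -> (0 < r)%R ->
  exists2 A, near_covers2 S Lambda phi0 Q e A &
    cost_pow phi0 Z a A <= Hfun phi0 Z a Q + r%:E.
Proof.
move=> a0 a1 e0 r0; have [h h0 hE] := Hfun_fin a0 a1.
have r20 : (0 < r / 2)%R by rewrite divr_gt0.
pose psi : {measure set (past_space S) -> \bar R} := pow_density phi0 Z_meas a.
have psifin : psi setT < +oo by exact: pow_density_fin.
have m0 : (0 < Num.min e (r / 2))%R by rewrite lt_min e0.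
have [r' r'0|B [QB cB lB pB]] := @lexicographic_cover _ (past_space S) R S T TK SK mS
    phi0 psi Lambda Q (h + r / 2)%R _ phi0_fin psifin Lambda_fin invL _ m0.
  (* At every tolerance the infimum is at most [h], so some cover costs less than h + r / 2. *)
  have : hinf a r' < (h + r / 2)%R%:E.
    by apply: le_lt_trans (hinf_le_Hfun a r'0) _; rewrite hE lte_fin ltrDl.
  move=> /ereal_inf_lt[_ [A [QA cA] <-] pA].
  exists (fun n => iter n S @^-1` A n); split => //.
    exact: covers_past_cover.
  by rewrite -(outer_past_outer TK SK).
have QA := past_cover_covers TK SK QB.
have cE (mu : set X -> \bar R) :
    cost S mu (fun n => iter n T @^-1` B n) = @past_cost _ (past_space S) R mu B.
  by apply: eq_eseriesr => n _; rewrite (congr1 (@^~ n) (preimage_iterK SK B)).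
exists (fun n => iter n T @^-1` B n).
  apply: (near_covers2S (e := Num.min e (r / 2)%R)); first by rewrite ge_min lexx.
  by rewrite near_covers2E; split; split; rewrite ?(outer_past_outer TK SK) ?cE.
rewrite -[cost_pow _ _ _ _]/(cost S psi _) cE; apply/ltW/(lt_le_trans pB).
have : (Num.min e (r / 2) <= r / 2)%R by rewrite ge_min lexx orbT.
by rewrite hE -EFinD lee_fin; lra.
Qed.

Lemma hinf_le_cost_pow a e A : (0 < e)%R -> near_covers2 S Lambda phi0 Q e A ->
  hinf a e <= cost_pow phi0 Z a A.
Proof.
move=> e0; rewrite near_covers2E => -[_ hA].
by apply: ereal_inf_lbound; exists A.
Qed.

(** * Interpolation of H and J in the exponent *)

Section interpolation.
Variables (be al t : R).
Hypotheses (be0 : (0 <= be)%R) (be1 : (be <= 1)%R).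
Hypotheses (al0 : (0 <= al)%R) (al1 : (al <= 1)%R).
Hypotheses (t0 : (0 <= t)%R) (t1 : (t <= 1)%R).
Local Notation ga := ((1 - t) * be + t * al)%R.

Let t1' : (0 <= 1 - t)%R. Proof. by rewrite subr_ge0. Qed.

(** At small tolerance both costs of every cover exceed the J values by at most [r]. Positive [r]
    keeps the normalising bounds positive even where J vanishes; then [r] tends to 0. *)
Lemma Jfun_interpolate : Jfun phi0 Z Lambda ga Q <=
  Jfun phi0 Z Lambda be Q `^ (1 - t) * Jfun phi0 Z Lambda al Q `^ t.
Proof.
have [u u0 uE] := Jfun_fin be0 be1; have [v v0 vE] := Jfun_fin al0 al1.
rewrite uE vE; apply: le_poweR_prod_at_right => // r r0.
have [e e0 He] := Jfun_adherent be0 be1 r0.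
have [e' e'0 He'] := Jfun_adherent al0 al1 r0.
have m0 : (0 < Num.min e e')%R by rewrite lt_min e0.
rewrite JfunE; apply: (@le_trans _ _ (jsup ga (Num.min e e'))).
  by apply: ereal_inf_lbound; exists (Num.min e e').
apply: ge_ereal_sup => _ [A hA <-].
apply: cost_pow_interpolate; rewrite ?ltr_wpDl//.
- by apply: covers_measurable; move: hA; rewrite near_covers2E => -[[]].
- by rewrite EFinD -uE; apply: He; apply: near_covers2S hA; rewrite ge_min lexx.
- by rewrite EFinD -vE; apply: He'; apply: near_covers2S hA; rewrite ge_min lexx orbT.
Qed.

(** J controls the [be]-cost of all covers of small tolerance, so it suffices to choose one whose
    [al]-cost is close to H. *)
Lemma Hfun_interpolate_right : Hfun phi0 Z ga Q <=
  Jfun phi0 Z Lambda be Q `^ (1 - t) * Hfun phi0 Z al Q `^ t.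
Proof.
have [u u0 uE] := Jfun_fin be0 be1; have [v v0 vE] := Hfun_fin al0 al1.
rewrite uE vE; apply: le_poweR_prod_at_right => // r r0.
have [e e0 He] := Jfun_adherent be0 be1 r0.
apply: (Hfun_le e0) => e' e'0 e'e.
have [A hA cA] := Hfun_adherent al0 al1 e'0 r0.
apply: le_trans (hinf_le_cost_pow _ e'0 hA) _.
apply: cost_pow_interpolate; rewrite ?ltr_wpDl//.
- by apply: covers_measurable; move: hA; rewrite near_covers2E => -[[]].
- by rewrite EFinD -uE; apply: He; exact: near_covers2S hA.
- by rewrite EFinD -vE.
Qed.

Lemma Hfun_interpolate_left : Hfun phi0 Z ga Q <=
  Hfun phi0 Z be Q `^ (1 - t) * Jfun phi0 Z Lambda al Q `^ t.
Proof.
have [u u0 uE] := Hfun_fin be0 be1; have [v v0 vE] := Jfun_fin al0 al1.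
rewrite uE vE; apply: le_poweR_prod_at_right => // r r0.
have [e e0 He] := Jfun_adherent al0 al1 r0.
apply: (Hfun_le e0) => e' e'0 e'e.
have [A hA cA] := Hfun_adherent be0 be1 e'0 r0.
apply: le_trans (hinf_le_cost_pow _ e'0 hA) _.
apply: cost_pow_interpolate; rewrite ?ltr_wpDl//.
- by apply: covers_measurable; move: hA; rewrite near_covers2E => -[[]].
- by rewrite EFinD -uE.
- by rewrite EFinD -vE; apply: He; exact: near_covers2S hA.
Qed.

End interpolation.

End dynamical_functionals.

Theorem lemma28 (R : realType) (d : measure_display) (X : measurableType d)
    (S : X -> X) (bijS : bijective S)
    (phi0 : {finite_measure set (past_space S) -> \bar R})
    (Lambda : {finite_measure set (past_space S) -> \bar R})
    (invL : forall A : set (past_space S), measurable A ->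
       Lambda (S @^-1` A) = Lambda A)
    (domL : Lambda `<< phi0)
    (Z : past_space S -> R)
    (Z_ge0 : forall x, 0 <= Z x)
    (Z_meas : measurable_fun setT Z)
    (Z_density : forall A : set (past_space S), measurable A ->
       Lambda A = (\int[phi0]_(x in A) (Z x)%:E)%E)
    (Q : set X) (beta alpha0 alpha : R)
    (beta_ge0 : 0 <= beta) (le_beta_alpha0 : beta <= alpha0)
    (le_alpha0_alpha : alpha0 <= alpha) (alpha_le1 : alpha <= 1)
    (neq_alpha_beta : alpha <> beta) :
  [/\ (Jfun phi0 Z Lambda alpha0 Q
        <= Jfun phi0 Z Lambda beta Q
             `^ (1 - (alpha0 - beta) / (alpha - beta))
           * Jfun phi0 Z Lambda alpha Q
             `^ ((alpha0 - beta) / (alpha - beta)))%E,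
      (Hfun phi0 Z alpha0 Q
        <= Jfun phi0 Z Lambda beta Q
             `^ (1 - (alpha0 - beta) / (alpha - beta))
           * Hfun phi0 Z alpha Q
             `^ ((alpha0 - beta) / (alpha - beta)))%E
    & (Hfun phi0 Z alpha0 Q
        <= Hfun phi0 Z beta Q
             `^ (1 - (alpha0 - beta) / (alpha - beta))
           * Jfun phi0 Z Lambda alpha Q
             `^ ((alpha0 - beta) / (alpha - beta)))%E ].
Proof.
have [T SK TK] := bijS.
have ab0 : 0 < alpha - beta.
  rewrite subr_gt0 lt_neqAle (le_trans le_beta_alpha0 le_alpha0_alpha) andbT.
  by apply/eqP => /esym.
have al0 : 0 <= alpha.
  exact: le_trans beta_ge0 (le_trans le_beta_alpha0 le_alpha0_alpha).
have be1 : beta <= 1.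
  exact: le_trans (le_trans le_beta_alpha0 le_alpha0_alpha) alpha_le1.
set t := (alpha0 - beta) / (alpha - beta).
have t0 : 0 <= t by apply: divr_ge0; [rewrite subr_ge0|exact: ltW].
have t1 : t <= 1 by rewrite ler_pdivrMr// mul1r lerB.
(* The exponent of the theorem is the weight that makes [alpha0] a convex combination of [beta] and
   [alpha]. *)
have -> : alpha0 = (1 - t) * beta + t * alpha.
  by rewrite /t; field; rewrite gt_eqF.
split.
- exact: (Jfun_interpolate TK SK invL Z_ge0 Z_meas Z_density Q).
- exact: (Hfun_interpolate_right TK SK invL Z_ge0 Z_meas Z_density Q).
- exact: (Hfun_interpolate_left TK SK invL Z_ge0 Z_meas Z_density Q).
Qed.
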